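(* Let $\Bbbk$ be a field of characteristic zero and let $\mathbf{M},\mathbf{s},c_L,c_M\in\Bbbk$. The massive module $\widetilde{V}(\mathbf{M},\mathbf{s},c_L,c_M)$ over the BMS$_3$ algebra is irreducible if and only if $\mathbf{M}+\frac{n^2-1}{24}c_M\neq 0$ for every positive integer $n$.
   Context: The BMS$_3$ algebra $\mathfrak{bms}$ over $\Bbbk$ has basis $\{L_n,M_n\mid n\in\mathbb{Z}\}\cup\{C_L,C_M\}$, with $C_L,C_M$ central and brackets $[L_n,L_m]=(n-m)L_{n+m}+\frac1{12}n(n^2-1)\delta_{m,-n}C_L$, $[L_n,M_m]=(n-m)M_{n+m}+\frac1{12}n(n^2-1)\delta_{m,-n}C_M$, $[M_n,M_m]=0$. Let $\widehat{\mathfrak h}$ be the subalgebra spanned by $\{M_n\mid n\in\mathbb{Z}\}\cup\{L_0,C_L,C_M\}$, and let $\Bbbk|\mathbf{M},\mathbf{s}\rangle$ be the one-dimensional $\widehat{\mathfrak h}$-module with $L_0$ acting by $\mathbf{s}$, $M_0$ by $\mathbf{M}$, $C_L$ by $c_L$, $C_M$ by $c_M$, and $M_n$ by $0$ for $n\neq 0$. The massive module is $\widetilde V(\mathbf{M},\mathbf{s},c_L,c_M)=\mathrm{Ind}_{\widehat{\mathfrak h}}^{\mathfrak{bms}}\Bbbk|\mathbf{M},\mathbf{s}\rangle$. *)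

(* Defs.v *)
From HB Require Import structures.
From mathcomp Require Import all_boot all_order all_algebra.
Set Implicit Arguments. Unset Strict Implicit. Unset Printing Implicit Defensive.
Import Order.TTheory GRing.Theory Num.Theory.
Local Open Scope ring_scope.

Section BMS.
Variable k : fieldType.

Definition klinear (V W : lmodType k) (f : V -> W) : Prop :=
  forall (a : k) (x y : V), f (a *: x + y) = a *: f x + f y.

Definition cocycle (n m : int) : k :=
  if m == - n then (n ^+ 3 - n)%:~R / 12%:R else 0.

Definition is_bms_rep (V : lmodType k) (L M : int -> V -> V) (CL CM : V -> V)
  : Prop :=
  [/\ (forall n, klinear (L n)), (forall n, klinear (M n)),
      klinear CL, klinear CM &
  [/\ (forall n m x, L n (L m x) - L m (L n x)
                     = (n - m)%:~R *: L (n + m) x + cocycle n m *: CL x),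
      (forall n m x, L n (M m x) - M m (L n x)
                     = (n - m)%:~R *: M (n + m) x + cocycle n m *: CM x),
      (forall n m x, M n (M m x) = M m (M n x)) &
      [/\ (forall n x, CL (L n x) = L n (CL x) /\ CL (M n x) = M n (CL x)),
      (forall n x, CM (L n x) = L n (CM x) /\ CM (M n x) = M n (CM x))
      & (forall x, CL (CM x) = CM (CL x))]]].

(* v spans a copy of the one-dimensional h^-module k|Mb, s> *)
Definition massive_vector (Mb s cL cM : k) (V : lmodType k)
  (L M : int -> V -> V) (CL CM : V -> V) (v : V) : Prop :=
  [/\ L 0 v = s *: v, M 0 v = Mb *: v, CL v = cL *: v, CM v = cM *: v &
      forall n : int, n != 0 -> M n v = 0].

Definition bms_hom (V W : lmodType k)
  (L M : int -> V -> V) (CL CM : V -> V)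
  (L' M' : int -> W -> W) (CL' CM' : W -> W) (f : V -> W) : Prop :=
  [/\ klinear f, (forall n x, f (L n x) = L' n (f x)),
      (forall n x, f (M n x) = M' n (f x)),
      (forall x, f (CL x) = CL' (f x)) & (forall x, f (CM x) = CM' (f x))].

(* (V, v) is the induced module Ind_{h^}^{bms} k|Mb,s>, characterized by the
   universal property of induction (Frobenius reciprocity): bms-module maps
   out of it correspond exactly to vectors of the target on which h^ acts by
   the same character. *)
Definition is_massive_module (Mb s cL cM : k) (V : lmodType k)
  (L M : int -> V -> V) (CL CM : V -> V) (v : V) : Prop :=
  [/\ is_bms_rep L M CL CM, massive_vector Mb s cL cM L M CL CM v &
   forall (W : lmodType k) (L' M' : int -> W -> W) (CL' CM' : W -> W) (w : W),
     is_bms_rep L' M' CL' CM' -> massive_vector Mb s cL cM L' M' CL' CM' w ->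
     exists f : V -> W,
       [/\ bms_hom L M CL CM L' M' CL' CM' f, f v = w &
        forall g : V -> W, bms_hom L M CL CM L' M' CL' CM' g -> g v = w ->
          forall x, g x = f x]].

Definition bms_submodule (V : lmodType k) (L M : int -> V -> V) (CL CM : V -> V)
  (S : V -> Prop) : Prop :=
  [/\ S 0, (forall a x y, S x -> S y -> S (a *: x + y)),
      (forall n x, S x -> S (L n x) /\ S (M n x)) &
      (forall x, S x -> S (CL x) /\ S (CM x))].

Definition bms_irreducible (V : lmodType k) (L M : int -> V -> V) (CL CM : V -> V)
  : Prop :=
  (exists x : V, x != 0) /\
  forall S : V -> Prop, bms_submodule L M CL CM S ->
    (forall x, S x -> x = 0) \/ (forall x, S x).

End BMS.

(* Main.v *)
(* Commuting M_(-n) through L_n gives, on the generator v,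
   M_(-n) L_n v = - 2 n (Mb + (n^2 - 1) / 24 cM) v; this scalar (without the
   sign) is [lowering_coef n] below. Filter the module by the number of L's. On
   the associated graded space, a polynomial algebra on symbols x_n (n <> 0),
   L_n acts as multiplication by x_n and M_(-n) as - lowering_coef n times
   d/dx_n.

   If no coefficient vanishes, sum_n lowering_coef(n)^-1 L_n M_(-n) acts modulo
   lower filtration as minus the Euler operator, so (in characteristic 0) any
   element killed by all the M_n with n <> 0 is a multiple of v. A nonzero
   submodule is thus brought down to v by applying M_n's. This direction needs
   no basis of the module beyond v <> 0.

   If lowering_coef n = 0, the character extends by L_n |-> 0 to the stabilizer
   enlarged by L_n. The kernel of the map from the massive module to the module
   induced from the enlarged stabilizer contains L_n v and not v; and L_n v is
   nonzero. Both nonvanishing claims come from a Poincare-Birkhoff-Witt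
   construction of modules induced from a character. *)
Require Import Defs.
From HB Require Import structures.
From mathcomp Require Import all_boot all_order all_algebra.
From mathcomp Require Import freeg boolp ring zify.
Import Order.TTheory GRing.Theory Num.Theory.
Local Open Scope ring_scope.

Set Implicit Arguments.
Unset Strict Implicit.
Unset Printing Implicit Defensive.

(** * Linear spans, and linear extension from a basis *)

Inductive spanned (k : pzRingType) (V : lmodType k) (P : V -> Prop) : V -> Prop :=
| spanned0 : spanned P 0
| spannedS a x y : P x -> spanned P y -> spanned P (a *: x + y).

Section Span.
Variables (k : pzRingType) (V : lmodType k).
Implicit Types (P Q : V -> Prop) (x y : V).

Lemma spanned_gen P x : P x -> spanned P x.
Proof. by move=> Px; rewrite -[x]addr0 -[x]scale1r; apply: spannedS => //; apply: spanned0. Qed.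

Lemma spannedD P x y : spanned P x -> spanned P y -> spanned P (x + y).
Proof.
move=> Sx Sy; elim: Sx => [|a z t Pz _ IH]; first by rewrite add0r.
by rewrite -addrA; apply: spannedS.
Qed.

Lemma spannedZ P a x : spanned P x -> spanned P (a *: x).
Proof.
elim=> [|b z t Pz _ IH]; first by rewrite scaler0; apply: spanned0.
by rewrite scalerDr scalerA; apply: spannedS.
Qed.

Lemma spannedN P x : spanned P x -> spanned P (- x).
Proof. by rewrite -scaleN1r; apply: spannedZ. Qed.

Lemma spannedB P x y : spanned P x -> spanned P y -> spanned P (x - y).
Proof. by move=> Sx Sy; apply/spannedD/spannedN. Qed.

End Span.

Section SpanMap.
Variables (k : pzRingType) (V : lmodType k).
Implicit Types (P Q : V -> Prop) (x y : V).

Lemma spanned_map (W : lmodType k) (f : {linear V -> W}) P (Q : W -> Prop) x :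
  (forall y, P y -> spanned Q (f y)) -> spanned P x -> spanned Q (f x).
Proof.
move=> fP; elim=> [|a y z Py _ IH]; first by rewrite linear0; apply: spanned0.
by rewrite linearP; apply: spannedD => //; apply/spannedZ/fP.
Qed.

Lemma spanned_sub P Q x : (forall y, P y -> spanned Q y) -> spanned P x -> spanned Q x.
Proof. exact: (@spanned_map V idfun). Qed.

Lemma spanned_eq (W : lmodType k) (f g : {linear V -> W}) P x :
  (forall y, P y -> f y = g y) -> spanned P x -> f x = g x.
Proof.
move=> fg; elim=> [|a y z Py _ IH]; first by rewrite !linear0.
by rewrite !linearP fg // IH.
Qed.

End SpanMap.

Lemma fglift_is_linear (R : nzRingType) (M : lmodType R) (K : choiceType)
  (f : K -> M) : linear (fglift f : {freeg K / R} -> M).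
Proof.
have U (b : R) x : << b *g x >> = b *: << x >> :> {freeg K / R}.
  by apply/eqP/freeg_eqP => z; rewrite coeffZ !coeffU mul1r.
have l0 : fglift f (0 : {freeg K / R}) = 0.
  by rewrite -(subrr 0) lift_is_additive subrr.
have lD x y : fglift f (x + y) = fglift f x + fglift f y.
  rewrite -[y in LHS]opprK lift_is_additive -[- y]sub0r lift_is_additive.
  by rewrite l0 sub0r opprK.
move=> a x y; rewrite lD; congr (_ + _).
elim/freeg_ind_dom0: x => [|b z x _ _ IH].
  by rewrite scaler0 l0 scaler0.
rewrite scalerDr !lD scalerDr IH; congr (_ + _).
by rewrite U scalerA -!U !liftU scalerA.
Qed.

HB.instance Definition _ (R : nzRingType) (M : lmodType R) (K : choiceType)
  (f : K -> M) := GRing.isLinear.Build R {freeg K / R} M *:%R (fglift f)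
    (@fglift_is_linear R M K f).

(** * Modules induced from a character, after Poincare-Birkhoff-Witt *)

Section Induced.

Variables (k : comNzRingType) (d0 : Order.disp_t) (G : orderType d0).
Variables (h : pred G) (chi : G -> k).
Variables (bet : G -> G -> k) (gam : G -> G -> G) (kap : G -> G -> k).

Local Notation W := {freeg (seq G) / k}.
Local Notation e w := (<< w >> : W).

(* The bracket is [x, y] = bet x y * gam x y + kap x y, the last term being a
   scalar by which a central element acts; [brk F u x y] is the action of [x, y]
   on u when each generator z acts on u as F z. *)
Definition brk (V : lmodType k) (F : G -> V) (u : V) (x y : G) : V :=
  bet x y *: F (gam x y) + kap x y *: u.

Definition good (w : seq G) := sorted <=%O w && all (predC h) w.

(* The top-degree part of x . w: generators in h do not raise the degree. *)
Definition lead (x : G) (w : seq G) : W :=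
  if h x then 0 else e (sort <=%O (x :: w)).

(* Pushes x to the right past the head y of w by x y = y x + [x, y]. The fuel d
   bounds the length of w. Since y . lead x w' = lead x w, only the part of
   x . w' of length at most that of w' is acted on recursively. *)
Fixpoint act (d : nat) (x : G) (w : seq G) : W :=
  if good (x :: w) then e (x :: w) else
  match d, w with
  | d'.+1, y :: w' =>
    lead x w + fglift (act d' y) (act d' x w' - lead x w')
      + brk (fun z => act d' z w') (e w') x y
  | _, _ => chi x *: e w
  end.

(* Only good words index basis vectors of the induced module; the other words of
   the free module are sent to 0, [op1] being the projection that kills them. *)
Definition op (x : G) : W -> W :=
  fglift (fun w => if good w then act (size w) x w else 0).

Definition op1 : W -> W := fglift (fun w => if good w then e w else 0).

HB.instance Definition _ x := GRing.Linear.on (op x).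
HB.instance Definition _ := GRing.Linear.on op1.

Definition low (d : nat) : W -> Prop :=
  spanned (fun y => exists w, [/\ good w, (size w <= d)%N & y = e w]).

Lemma op_e x w : good w -> op x (e w) = act (size w) x w.
Proof. by move=> gw; rewrite /op liftU scale1r gw. Qed.

Lemma op1_e w : good w -> op1 (e w) = e w.
Proof. by move=> gw; rewrite /op1 liftU scale1r gw. Qed.

Lemma low_e d w : good w -> (size w <= d)%N -> low d (e w).
Proof. by move=> gw sw; apply: spanned_gen; exists w. Qed.

Lemma low_le d d' x : (d <= d')%N -> low d x -> low d' x.
Proof.
move=> le; apply: spanned_sub => y [w [gw sw ->]].
by apply: low_e => //; apply: leq_trans le.
Qed.

Lemma good_cons x w :
  good (x :: w) = [&& ~~ h x, all (>= x)%O w & good w].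
Proof.
rewrite /good /= path_sortedE; last exact: le_trans.
by rewrite -!andbA; do !bool_congr.
Qed.

Lemma good_sort x w : ~~ h x -> good w -> good (sort <=%O (x :: w)).
Proof.
by move=> hx /andP[_ aw]; rewrite /good sort_sorted ?all_sort /= ?hx.
Qed.

Lemma lead_low x w : good w -> low (size w).+1 (lead x w).
Proof.
rewrite /lead; case: ifP => [_ _|hx gw]; first exact: spanned0.
by apply: low_e; [apply: good_sort; rewrite ?hx | rewrite size_sort].
Qed.

Lemma lead_good x w : good (x :: w) -> lead x w = e (x :: w).
Proof.
move=> gw; rewrite /lead ifN; last by move: gw; rewrite good_cons => /andP[].
by rewrite sorted_sort //; [apply: le_trans | case/andP: gw].
Qed.

(** Triangularity: up to lower terms, x acts as multiplication in the symmetric algebra on the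
    generators outside [h]. In the recursive case [lead] cancels, and the rest is at most one
    generator applied to words no longer than the tail. *)
Lemma act_low d x w : good w -> (size w <= d)%N ->
  low (size w) (act d x w - lead x w).
Proof.
elim: d x w => [|d IH] x w gw sw.
  move: gw sw => /=; case: w => // g0 _; case: ifP => gx.
    by rewrite lead_good // subrr; apply: spanned0.
  have hx : h x by move: gx; rewrite /good /= andbT => /negbFE.
  by rewrite /lead hx subr0; apply/spannedZ/low_e.
move=> /=; case: ifP => gx.
  by rewrite lead_good // subrr; apply: spanned0.
case: w gw sw gx => [|y w] gw sw gx.
  have hx : h x by move: gx; rewrite /good /= andbT => /negbFE.
  by rewrite /lead hx subr0; apply/spannedZ/low_e.
have gw' : good w by move: gw; rewrite good_cons => /and3P[].
have low_act z t : good t -> (size t <= size w)%N -> low (size w).+1 (act d z t).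
  move=> gt st; rewrite -[act d z t](subrK (lead z t)).
  apply: spannedD; last by apply: low_le (lead_low _ gt).
  by apply: (@low_le (size t)); [apply: leqW | apply: IH => //; apply: leq_trans st _].
rewrite -[lead _ _ + _ + _]addrA addrAC subrr add0r.
apply: spannedD; last first.
  by apply: spannedD; apply: spannedZ; [apply: low_act | apply: low_e].
apply: spanned_map (IH x w gw' sw) => _ [t [gt st ->]].
by rewrite /= liftU scale1r; apply: low_act.
Qed.

(** By [act_low], recursive calls only meet words no longer than the tail, so the fuel never runs
    out. *)
Lemma act_stable d d' x w : good w -> (size w <= d)%N -> (size w <= d')%N ->
  act d x w = act d' x w.
Proof.
elim: d d' x w => [|d IH] d' x w gw sw sw'.
  by move: sw; rewrite leqn0 => /nilP->; case: d' {sw'}.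
case: w d' gw sw sw' => [|y w] [|d'] //= gw sw sw'.
have gw' : good w by move: gw; rewrite good_cons => /and3P[].
case: ifP => // _; rewrite /brk !(IH d' _ w) //; congr (_ + _ + _).
rewrite (@spanned_eq _ _ _ (fglift _) (fglift (act d' y)) _ _ _
  (act_low x gw' sw')) // => _ [t [gt st ->]].
by rewrite /= !liftU !scale1r (IH d') // (leq_trans st).
Qed.

Lemma act_fuel d x w : good w -> (size w <= d)%N -> act d x w = op x (e w).
Proof. by move=> gw sw; rewrite op_e //; apply: act_stable. Qed.

Lemma op_low x w : good w -> low (size w) (op x (e w) - lead x w).
Proof. by move=> gw; rewrite op_e //; apply: act_low. Qed.

Lemma op_good x w : good (x :: w) -> op x (e w) = e (x :: w).
Proof.
move=> gxw; have gw : good w by move: gxw; rewrite good_cons => /and3P[].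
by rewrite op_e //; case: (w) gxw => [|y t] /= ->.
Qed.

Lemma op_nil x : h x -> op x (e [::]) = chi x *: e [::].
Proof. by move=> hx; rewrite op_e //= /good /= hx. Qed.

Lemma op_cons x y w : good (y :: w) -> ~~ good [:: x, y & w] ->
  op x (e (y :: w)) =
    op y (op x (e w)) + brk (fun z => op z (e w)) (e w) x y.
Proof.
move=> gyw gxyw; have gw : good w by move: gyw; rewrite good_cons => /and3P[].
rewrite op_e // [act _ _ _]/= (negbTE gxyw) /brk !act_fuel //.
congr (_ + _).
have -> : lead x (y :: w) = op y (lead x w).
  rewrite /lead; case: ifP => hx; first by rewrite linear0.
  (* Otherwise x could be prepended to [y :: w]. Hence y stays in front when x is sorted into the
     word. *)
  have yx : (y <= x)%O.
    rewrite leNgt; apply: contra gxyw => xy; rewrite good_cons hx gyw /= ltW //.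
    rewrite andbT; move: gyw; rewrite good_cons => /and3P[_ /allP yw _].
    by apply/allP => z /yw; apply/le_trans/ltW.
  have gs : good (y :: sort <=%O (x :: w)).
    rewrite good_cons good_sort ?hx // all_sort /= yx.
    by move: gyw; rewrite good_cons => /and3P[-> ->].
  rewrite op_good //; congr (<< _ >>).
  apply: (sorted_eq le_trans le_anti); first exact/sort_sorted/le_total.
    by case/andP: gs.
  by apply/permP => p; rewrite /= !(permP (permEl (perm_sort _ _))) /= addnCA.
have -> : fglift (act (size w) y) (op x (e w) - lead x w)
   = op y (op x (e w) - lead x w).
  apply: (@spanned_eq _ _ _ (fglift _) (op y) _ _ _ (op_low x gw)) => _ [t [gt st ->]].
  by rewrite /= liftU scale1r act_fuel.
by rewrite linearB /= addrC subrK.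
Qed.

Lemma op1K u : op1 (op1 u) = op1 u.
Proof.
elim/freeg_ind_dom0: u => [|a w u _ _ IH]; first by rewrite !linear0.
rewrite !linearD /= IH; congr (_ + _); rewrite [op1 <<_ *g _>>]liftU.
by case: ifP => gw; rewrite linearZ /= ?op1_e // linear0.
Qed.

Hypothesis bet_xx : forall x, bet x x = 0.
Hypothesis kap_xx : forall x, kap x x = 0.
Hypothesis betN : forall x y, bet y x = - bet x y.
Hypothesis kapN : forall x y, kap y x = - kap x y.
Hypothesis gamC : forall x y, gam y x = gam x y.
(** [[x, y], z] = [[x, z], y] - [[y, z], x] under any assignment [F]; the scalar parts of the inner
    brackets are central and drop out. *)
Hypothesis jacobi : forall (F : G -> W) (u : W) x y z,
  bet x y *: brk F u (gam x y) z =
    bet x z *: brk F u (gam x z) y - bet y z *: brk F u (gam y z) x.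
(** [chi] vanishes on [h, h]. Phrased on the empty word, this lets [gam x y] leave [h] where
    [bet x y] is 0. *)
Hypothesis chi_brk : forall x y, h x -> h y ->
  brk (fun z => op z (e [::])) (e [::]) x y = 0.

Definition rel x y (u : W) :=
  op x (op y u) - op y (op x u) = brk (op^~ u) u x y.

Lemma relC x y u : rel y x u -> rel x y u.
Proof.
rewrite /rel /brk betN kapN gamC => /(congr1 -%R).
by rewrite opprB => ->; rewrite opprD !scaleNr !opprK.
Qed.

Lemma rel_lin x y a u v : rel x y u -> rel x y v -> rel x y (a *: u + v).
Proof.
rewrite /rel => Hu Hv; rewrite !linearP /= addrACA -scalerDr Hu Hv.
by rewrite /brk [op _ (a *: u + v)]linearP /= !scalerDr !scalerA ![_ * a]mulrC addrACA.
Qed.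

Lemma rel_span x y P u : (forall v, P v -> rel x y v) -> spanned P u -> rel x y u.
Proof.
move=> HP; elim=> [|a v z Pv _ IH]; last by apply: rel_lin => //; apply: HP.
by rewrite /rel /brk !linear0.
Qed.

(* When y can be prepended to w, the relation is the defining recursion, applied
   to whichever of x, y is larger. *)
Lemma rel_prep x y w : good (y :: w) -> rel x y (e w).
Proof.
move=> gyw; have [gxyw|gxyw] := boolP (good [:: x, y & w]); last first.
  by rewrite /rel op_good // op_cons // [X in X - _]addrC addrK.
have [<-|neq_xy] := eqVneq x y.
  by rewrite /rel subrr /brk bet_xx kap_xx !scale0r addr0.
have gxw : good (x :: w).
  move: gxyw; rewrite !good_cons => /and3P[hx /andP[_ xw] /and3P[_ _ gw]].
  exact/and3P.
apply: relC; rewrite /rel op_good // op_cons //; first by rewrite [X in X - _]addrC addrK.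
apply/negP; rewrite good_cons => /and3P[_ /andP[yx _] _].
move: gxyw; rewrite good_cons => /and3P[_ /andP[xy _] _].
by move: neq_xy; rewrite (@le_anti _ _ x y) ?eqxx // xy yx.
Qed.

Lemma op_brk x y z u :
  brk (op^~ (op z u)) (op z u) x y - op z (brk (op^~ u) u x y) =
  bet x y *: (op (gam x y) (op z u) - op z (op (gam x y) u)).
Proof.
by rewrite /brk linearP linearZ /= opprD addrACA subrr addr0 scalerBr.
Qed.

(** Induction on length. If neither x nor y can be prepended, the first letter j is moved left past
    both, and the double brackets combine by Jacobi into [[x, y], j]. On the empty word, x and y act
    by scalars and [chi_brk] applies. *)
Lemma op_rel x y w : good w -> rel x y (e w).
Proof.
have [n] := ubnP (size w); elim: n w x y => // n IH w x y sw gw.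
have [gxw|gxw] := boolP (good (x :: w)); first exact/relC/rel_prep.
have [gyw|gyw] := boolP (good (y :: w)); first exact/rel_prep.
case: w => [|j w] in gw sw gxw gyw *.
  move: gxw gyw; rewrite !good_cons /= !andbT !negbK => hx hy.
  rewrite /rel chi_brk // !op_nil // [op x _]linearZ [op y _]linearZ /= !op_nil //.
  by rewrite !scalerA mulrC subrr.
have gw' : good w by move: gw; rewrite good_cons => /and3P[].
(* In a . w, induction covers the words no longer than w, and j can be prepended to the leading
   word. *)
have rel_lead a b : ~~ good [:: a, j & w] -> rel b j (op a (e w)).
  move=> ga; rewrite -[op a _](subrK (lead a w)) addrC -[X in rel _ _ (X + _)]scale1r.
  apply: rel_lin; last first.
    apply: (rel_span _ (op_low a gw')) => _ [t [gt st ->]].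
    by apply: IH => //; apply: leq_ltn_trans st _.
  rewrite /lead; case: ifP => ha.
    by rewrite /rel /brk !linear0.
  apply: rel_prep; rewrite good_cons good_sort ?ha // all_sort /= andbT.
  move: (gw); rewrite good_cons => /and3P[-> /= jw _]; rewrite jw andbT.
  rewrite leNgt; apply: contra ga => aj; rewrite good_cons ha gw /= ltW //.
  by rewrite andbT; apply/allP => z /(allP jw); apply/le_trans/ltW.
rewrite /rel -(op_good gw).
have step a b : ~~ good [:: a, j & w] -> ~~ good [:: b, j & w] ->
    op b (op a (op j (e w))) = op j (op b (op a (e w)))
      + brk (op^~ (op a (e w))) (op a (e w)) b j
      + op b (brk (op^~ (e w)) (e w) a j).
  move=> ga gb; rewrite op_good // op_cons // linearD /=; congr (_ + _).
  by have /eqP := rel_lead a b ga; rewrite subr_eq addrC => /eqP.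
rewrite !step //.
have shuffle (V : zmodType) (p p' x1 y1 x2 y2 : V) :
    p + x1 + y1 - (p' + x2 + y2) = (p - p') + ((x1 - y2) - (x2 - y1)).
  by rewrite !opprD !opprK !addrA [RHS](ACl (1 * 3 * 6 * 2 * 5 * 4)).
rewrite shuffle !op_brk !IH // -linearB /= IH // -jacobi.
by rewrite -[X in bet x y *: X]IH // -op_brk addrC subrK.
Qed.

Lemma rel_op1 x y u : rel x y (op1 u).
Proof.
elim/freeg_ind_dom0: u => [|a w u _ _ IH]; first by rewrite /rel /brk !linear0.
rewrite linearD /= [op1 <<_ *g _>>]liftU; apply: rel_lin => //.
by case: ifP => gw; [apply: op_rel | rewrite /rel /brk !linear0].
Qed.

Lemma op1_op x u : op1 (op x (op1 u)) = op x (op1 u).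
Proof.
elim/freeg_ind_dom0: u => [|a w u _ _ IH]; first by rewrite !linear0.
rewrite [op1 (_ + u)]linearD /= [op x _]linearD [LHS]linearD /= IH; congr (_ + _).
rewrite [op1 <<_ *g _>>]liftU [op x _]linearZ [LHS]linearZ /=; congr (_ *: _).
case: ifP => gw; last by rewrite !linear0.
have: low (size w).+1 (op x (e w)).
  rewrite -[op x _](subrK (lead x w)); apply: spannedD (lead_low x gw).
  exact: low_le (op_low x gw).
by apply: (@spanned_eq _ _ _ op1 idfun) => _ [t [gt _ ->]]; rewrite /= op1_e.
Qed.

End Induced.

(** * Modules in which a massive vector is also killed by L_n0 *)

Section Model.

Variables (k : fieldType) (Mb s cL cM : k).

Definition lowering_coef (n : int) : k := (2 * n)%:~R * Mb + (n ^+ 3 - n)%:~R / 12%:R * cM.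

Lemma lowering_coefN n : lowering_coef (- n) = - lowering_coef n.
Proof. rewrite /lowering_coef; ring. Qed.

Variable n0 : int.

(* (false, n) stands for L_n and (true, n) for M_n; the central elements act by
   the scalars cL and cM and need no generator. *)
Definition bms_gen := (bool *l int)%type.

Definition is_M (x : bms_gen) : bool := x.1.
Definition mode (x : bms_gen) : int := x.2.

(* With n0 = 0 this is the subalgebra of the massive module itself. *)
Definition stab (x : bms_gen) := is_M x || (mode x \in [:: 0; n0]).
Definition stab_char (x : bms_gen) : k :=
  if mode x == 0 then if is_M x then Mb else s else 0.

Definition bms_coef (x y : bms_gen) : k :=
  if is_M x && is_M y then 0 else (mode x - mode y)%:~R.
Definition bms_br (x y : bms_gen) : bms_gen :=
  (is_M x || is_M y, mode x + mode y).
Definition bms_central (x y : bms_gen) : k :=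
  if is_M x && is_M y then 0 else
  cocycle k (mode x) (mode y) * if is_M x || is_M y then cM else cL.

Lemma cocycleN n m : cocycle k m n = - cocycle k n m.
Proof.
rewrite /cocycle -eqr_oppLR eq_sym; case: eqP => [->|_]; last by rewrite oppr0.
by rewrite -mulNr -rmorphN /=; congr (_%:~R / _); ring.
Qed.

Lemma bms_jacobi (V : lmodType k) (F : bms_gen -> V) u x y z :
  bms_coef x y *: brk bms_coef bms_br bms_central F u (bms_br x y) z =
    bms_coef x z *: brk bms_coef bms_br bms_central F u (bms_br x z) y
    - bms_coef y z *: brk bms_coef bms_br bms_central F u (bms_br y z) x.
Proof.
case: x y z => [a n] [b m] [c p]; rewrite /brk /=.
have -> : bms_br (bms_br (a, n) (c, p)) (b, m) = bms_br (bms_br (a, n) (b, m)) (c, p).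
  by rewrite /bms_br /is_M /mode /= (orbAC a) (addrAC n).
have -> : bms_br (bms_br (b, m) (c, p)) (a, n) = bms_br (bms_br (a, n) (b, m)) (c, p).
  by rewrite /bms_br /is_M /mode /= (orbC _ a) orbA (addrC _ n) (addrA n).
rewrite !scalerDr !scalerA opprD addrACA -!scalerBl.
congr (_ *: _ + _ *: _).
  rewrite /bms_coef /bms_br /is_M /mode /=.
  by case: a; case: b; case: c => //=; rewrite ?intrD ?intrN; ring.
rewrite /bms_coef /bms_central /bms_br /is_M /mode /= /cocycle.
(* All three cocycles are supported on n + m + p = 0. *)
have -> : (m == - (n + p)) = (p == - (n + m)).
  by apply/eqP/eqP => ->; ring.
have -> : (n == - (m + p)) = (p == - (n + m)).
  by apply/eqP/eqP => ->; ring.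
case: eqP => [->|_]; last by case: a; case: b; case: c => /=; ring.
by case: a; case: b; case: c => /=; rewrite ?intrD ?intrN ?rmorphXn /= ?intrD ?intrN; ring.
Qed.

(** The only obstruction to being a character is the value on [L_n0, M_(-n0)], which is
    [lowering_coef n0]. *)
Lemma stab_char_brk x y : lowering_coef n0 = 0 -> stab x -> stab y ->
  bms_coef x y * stab_char (bms_br x y) + bms_central x y = 0.
Proof.
move=> a0; have a0' n : n \in [:: 0; n0] -> lowering_coef n = 0.
  by rewrite !inE => /orP[] /eqP->; rewrite // /lowering_coef; ring.
have LM n m : n \in [:: 0; n0] ->
    (n - m)%:~R * (if n + m == 0 then Mb else 0) + cocycle k n m * cM = 0.
  move=> /a0' {}a0; rewrite /cocycle addr_eq0 -eqr_oppLR eq_sym.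
  case: eqP => [->|_]; last by rewrite mulr0 mul0r addr0.
  by rewrite -a0 /lowering_coef; congr (_%:~R * _ + _); ring.
case: x y => [[] n] [[] m]; rewrite /bms_coef /bms_central /stab_char /bms_br /stab /is_M /mode /=.
- by move=> _ _; rewrite mul0r addr0.
- move=> _ /LM LMm; apply/eqP; rewrite -oppr_eq0 opprD -!mulNr -intrN opprB -cocycleN.
  by rewrite [n + m]addrC LMm.
- by move=> + _; apply: LM.
rewrite !inE => /orP[] /eqP-> /orP[] /eqP->.
- by rewrite subrr mul0r add0r /cocycle oppr0 eqxx expr0n subrr !mul0r.
- rewrite !add0r /cocycle oppr0; case: eqP => [->|_]; last by rewrite mulr0 mul0r addr0.
  by rewrite oppr0 expr0n subrr !mul0r addr0.
- rewrite oppr0 !addr0 /cocycle -eqr_oppLR oppr0 [0 == n0]eq_sym.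
  case: eqP => [->|_]; last by rewrite mulr0 mul0r addr0.
  by rewrite expr0n subrr !mulr0z !mul0r addr0.
rewrite subrr mul0r add0r /cocycle; case: eqP => [n0N|_]; last by rewrite mul0r.
have -> : n0 = 0 by lia.
by rewrite expr0n subrr !mul0r.
Qed.

(** For n0 <> 0, the bracket of L_n0 with itself names L_(2 n0), outside the subalgebra, but with
    coefficient 0. *)
Lemma stab_br x y : stab x -> stab y -> bms_coef x y = 0 \/ stab (bms_br x y).
Proof.
case: x y => [[] n] [[] m]; rewrite /bms_coef /bms_br /stab /is_M /mode /=; try by [left|right].
rewrite !inE => /orP[] /eqP-> /orP[] /eqP->; rewrite ?subrr ?add0r ?addr0 ?eqxx ?orbT; by [left|right].
Qed.

Local Notation W := {freeg (seq bms_gen) / k}.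
Local Notation mop := (@op k _ bms_gen stab stab_char bms_coef bms_br bms_central).
Local Notation mop1 := (@op1 k _ bms_gen stab).

Lemma mop_brk x y : lowering_coef n0 = 0 -> stab x -> stab y ->
  brk bms_coef bms_br bms_central (fun z => mop z << [::] >>) << [::] >> x y = 0 :> W.
Proof.
move=> a0 sx sy; have := stab_char_brk a0 sx sy; rewrite /brk.
have [-> |sxy E] := stab_br sx sy.
  by rewrite mul0r add0r => ->; rewrite !scale0r addr0.
by rewrite op_nil // scalerA -scalerDl E scale0r.
Qed.

Lemma mop_rel x y u : lowering_coef n0 = 0 ->
  mop x (mop y (mop1 u)) - mop y (mop x (mop1 u))
  = bms_coef x y *: mop (bms_br x y) (mop1 u) + bms_central x y *: mop1 u.
Proof.
move=> a0; apply: rel_op1.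
- by move=> z; rewrite /bms_coef subrr; case: ifP.
- move=> z; rewrite /bms_central; case: ifP => // _; rewrite /cocycle.
  case: eqP => [E|_]; last by rewrite mul0r.
  have -> : mode z = 0 by move: (mode z) E => i E; lia.
  by rewrite expr0n subrr !mul0r.
- move=> z t; rewrite /bms_coef andbC; case: ifP => _; first by rewrite oppr0.
  by rewrite -intrN opprB.
- move=> z t; rewrite /bms_central andbC orbC; case: ifP => _; first by rewrite oppr0.
  by rewrite cocycleN mulNr.
- by move=> z t; rewrite /bms_br orbC (addrC (mode z)).
- exact: bms_jacobi.
- by move=> z t; apply: mop_brk.
Qed.

(** Used with n0 = 0 to see that v and L_n v are nonzero, and with n0 = n for a module where L_n
    kills the generator. *)
Lemma massive_model : lowering_coef n0 = 0 ->
  exists (V : lmodType k) (L M : int -> V -> V) (CL CM : V -> V) (w : V),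
  [/\ is_bms_rep L M CL CM, massive_vector Mb s cL cM L M CL CM w, w != 0,
      (n0 != 0 -> L n0 w = 0) &
      forall n, n != 0 -> n != n0 -> L n w != 0].
Proof.
move=> a0.
(* The carrier is the whole free module; composing with [op1] makes everything, central elements
   included, act by 0 on words that are not good, so the relations hold there too. *)
exists W, (fun n => mop (false, n) \o mop1), (fun n => mop (true, n) \o mop1),
  (fun u => cL *: mop1 u), (fun u => cM *: mop1 u), << [::] >>.
have g0 : good stab [::] by [].
have op_op b n u : mop1 (mop (b, n) (mop1 u)) = mop (b, n) (mop1 u).
  exact: op1_op.
split.
- split; try by move=> n a x y /=; rewrite !linearP.
  + by move=> a x y /=; rewrite linearP scalerDr !scalerA mulrC.
  + by move=> a x y /=; rewrite linearP scalerDr !scalerA mulrC.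
  split.
  + move=> n m x /=; rewrite !op_op mop_rel //.
    by rewrite /bms_coef /bms_central /= scalerA.
  + move=> n m x /=; rewrite !op_op mop_rel //.
    by rewrite /bms_coef /bms_central /= scalerA.
  + move=> n m x /=; apply/eqP; rewrite -subr_eq0 !op_op mop_rel //.
    by rewrite /bms_coef /bms_central /= !scale0r addr0.
  split.
  + by move=> n x /=; rewrite !op_op !linearZ /= op1K.
  + by move=> n x /=; rewrite !op_op !linearZ /= op1K.
  + by move=> x; rewrite ![mop1 (_ *: _)]linearZ /= !scalerA mulrC.
- split=> [|||| n n_neq0] /=; rewrite op1_e // op_nil //.
  by rewrite /stab_char /mode /= (negbTE n_neq0) scale0r.
- by rewrite freegU_eq0 oner_neq0.
- move=> n0_neq0 /=; rewrite op1_e // op_nil.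
    by rewrite /stab_char /mode /= (negbTE n0_neq0) scale0r.
  by rewrite /stab /mode /= !inE eqxx !orbT.
move=> n nn0 nnn0 /=; rewrite op1_e // op_good ?freegU_eq0 ?oner_neq0 //.
by rewrite /good /= /stab /mode /= !inE (negbTE nn0) (negbTE nnn0).
Qed.

End Model.

(** * Irreducibility *)

Section Submodule.

Variables (k : fieldType) (V : lmodType k).
Variables (L M : int -> V -> V) (CL CM : V -> V) (S : V -> Prop).
Hypothesis S_sub : bms_submodule L M CL CM S.

(** The universal property ranges over [lmodType]s, so [S] is made boolean and then a subtype, to
    serve as a target. *)
Definition sub_pred : {pred V} := fun x => `[<S x>].

Lemma sub_predP x : x \in sub_pred <-> S x.
Proof. by rewrite unfold_in; split=> /asboolP. Qed.

Fact sub_pred_closed : GRing.submod_closed sub_pred.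
Proof.
case: S_sub => S0 Slin _ _; split=> [|a x y /sub_predP Sx /sub_predP Sy].
  exact/sub_predP.
exact/sub_predP/Slin.
Qed.

HB.instance Definition _ :=
  GRing.isSubmodClosed.Build k V sub_pred sub_pred_closed.

Record sub_mod := SubMod { sub_val : V; sub_valP : sub_val \in sub_pred }.
HB.instance Definition _ := [isSub for sub_val].
HB.instance Definition _ := [Choice of sub_mod by <:].
HB.instance Definition _ := [SubChoice_isSubLmodule of sub_mod by <:].

Definition sub_fun (f : V -> V) (fS : forall x, S x -> S (f x)) (x : sub_mod) :
    sub_mod :=
  SubMod (introT (asboolP _) (fS _ (elimT (asboolP _) (sub_valP x)))).

(* The map V -> S given by the universal property, followed by the inclusion
   S -> V, is the identity by uniqueness. *)
Lemma submodule_full Mb s cL cM v :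
  is_massive_module Mb s cL cM L M CL CM v -> S v -> forall x, S x.
Proof.
case=> [rep vec univ] Sv x.
have [S0 Slin SLM SC] := S_sub.
pose L' n := sub_fun (fun y Sy => (SLM n y Sy).1).
pose M' n := sub_fun (fun y Sy => (SLM n y Sy).2).
pose CL' := sub_fun (fun y Sy => (SC y Sy).1).
pose CM' := sub_fun (fun y Sy => (SC y Sy).2).
pose v' : sub_mod := SubMod (introT (asboolP _) Sv).
have lift_lin f fS : klinear f -> klinear (@sub_fun f fS).
  by move=> lf a y z; apply: val_inj; rewrite /= lf.
have [] := univ sub_mod L' M' CL' CM' v'.
- case: rep => lL lM lCL lCM [rLL rLM rMM [cLL cMM cLM]].
  split; try by [move=> n; apply: lift_lin | apply: lift_lin].
  split; try by move=> n m y; apply: val_inj => /=.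
  split; last by move=> y; apply: val_inj => /=.
    by move=> n y; split; apply: val_inj => /=; case: (cLL n (val y)).
  by move=> n y; split; apply: val_inj => /=; case: (cMM n (val y)).
- case: vec => v1 v2 v3 v4 v5.
  by split; try (move=> n n0); apply: val_inj => /=; rewrite // v5.
move=> f [f_hom fv _].
have [g [_ _ g_uniq]] := univ V L M CL CM v rep vec.
have -> : x = sub_val (f x).
  rewrite [LHS](g_uniq idfun) //; symmetry; apply: (g_uniq (sub_val \o f)).
    by case: f_hom => f1 f2 f3 f4 f5; split=> [a y z|n y|n y|y|y] /=;
       rewrite ?f1 ?f2 ?f3 ?f4 ?f5.
  by rewrite /= fv.
exact/sub_predP/sub_valP.
Qed.

End Submodule.

(** * The filtration by the number of L's, and the Euler operator *)

Section Filtration.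

Variables (k : fieldType) (Mb s cL cM : k) (V : lmodType k).
Variables (L M : int -> {linear V -> V}) (CL CM : {linear V -> V}) (v : V).
Hypothesis rep : is_bms_rep L M CL CM.
Hypothesis vec : massive_vector Mb s cL cM L M CL CM v.

Local Notation alpha := (lowering_coef Mb cM).

Definition word (u : seq int) : V := foldr (fun n x => L n x) v u.

(* The length bound is strict, so that [fil 0] is zero. *)
Definition fil (d : nat) : V -> Prop :=
  spanned (fun y => exists u, [/\ 0 \notin u, (size u < d)%N & y = word u]).

Lemma fil_word d u : 0 \notin u -> (size u < d)%N -> fil d (word u).
Proof. by move=> u0 su; apply: spanned_gen; exists u. Qed.

Lemma fil_le d d' x : (d <= d')%N -> fil d x -> fil d' x.
Proof.
move=> le; apply: spanned_sub => _ [u [u0 su ->]].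
by apply: fil_word => //; apply: leq_trans le.
Qed.

Lemma fil0 x : fil 0 x -> x = 0.
Proof. by elim=> // a y z [u []]. Qed.

Lemma commLL n m x :
  L n (L m x) = L m (L n x) + ((n - m)%:~R *: L (n + m) x + cocycle k n m *: CL x).
Proof. by case: rep => _ _ _ _ [<- _ _ _]; rewrite addrC subrK. Qed.

Lemma commML n m x :
  M m (L n x) = L n (M m x) - ((n - m)%:~R *: M (n + m) x + cocycle k n m *: CM x).
Proof. by case: rep => _ _ _ _ [_ <- _ _]; rewrite opprB addrC subrK. Qed.

Lemma CL_word u : CL (word u) = cL *: word u.
Proof.
elim: u => [|n u IH] /=; first by case: vec.
by case: rep => _ _ _ _ [_ _ _ [cLL _ _]]; rewrite (cLL n _).1 IH linearZ.
Qed.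

Lemma CM_word u : CM (word u) = cM *: word u.
Proof.
elim: u => [|n u IH] /=; first by case: vec.
by case: rep => _ _ _ _ [_ _ _ [_ cMM _]]; rewrite (cMM n _).1 IH linearZ.
Qed.

Lemma fil_CL d x : fil d x -> fil d (CL x).
Proof.
apply: spanned_map => _ [u [u0 su ->]]; rewrite CL_word; apply: spannedZ.
exact: fil_word.
Qed.

Lemma fil_CM d x : fil d x -> fil d (CM x).
Proof.
apply: spanned_map => _ [u [u0 su ->]]; rewrite CM_word; apply: spannedZ.
exact: fil_word.
Qed.

Lemma fil_Lneq0 d n x : n != 0 -> fil d x -> fil d.+1 (L n x).
Proof.
move=> n0; apply: spanned_map => _ [u [u0 su ->]].
by apply: (@fil_word _ (n :: u)) => //; rewrite inE negb_or eq_sym n0.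
Qed.

(** L_0 is not a letter of the words; it is commuted to the right until it reaches v, where it acts
    by s. *)
Lemma fil_L d n x : fil d x -> fil d.+1 (L n x).
Proof.
have [->|n0] := eqVneq n 0; last exact: fil_Lneq0.
apply: spanned_map => _ [u [u0 su ->]]; apply: (@fil_le (size u).+1); first exact: leqW.
elim: u u0 {su} => [|j u IH] u0 /=.
  by case: vec => -> _ _ _ _; apply: spannedZ; apply: (@fil_word _ [::]).
move: u0; rewrite inE negb_or eq_sym => /andP[j0 u0].
rewrite commLL; apply: spannedD; first by apply: fil_Lneq0 => //; apply: IH.
apply: spannedD; apply: spannedZ.
  by rewrite add0r; apply: fil_Lneq0 => //; apply: fil_word.
by apply: (@fil_le (size u).+1) => //; apply/fil_CL/fil_word.
Qed.

(** Each commutator trades a letter L_j for an M or a scalar; an M that reaches v acts by 0 or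
    [Mb]. *)
Lemma M_word m u : 0 \notin u ->
  fil (size u) (M m (word u) - (if m == 0 then Mb else 0) *: word u).
Proof.
elim: u m => [|j u IH] m /=.
  case: vec => _ v2 _ _ v5 _; case: eqP => [->|/eqP m0].
    by rewrite v2 subrr; apply: spanned0.
  by rewrite v5 // scale0r subrr; apply: spanned0.
rewrite inE negb_or eq_sym => /andP[j0 u0].
have fu : fil (size u).+1 (word u) by apply: fil_word.
rewrite commML addrAC -linearZ -linearB; apply: spannedB.
  by apply: fil_Lneq0 => //; apply: IH.
apply: spannedD; apply: spannedZ; last exact: fil_CM.
rewrite -[M _ _](subrK ((if j + m == 0 then Mb else 0) *: word u)).
apply: spannedD; last exact: spannedZ.
exact: fil_le (IH _ u0).
Qed.

Lemma fil_M d m x : fil d x -> fil d (M m x).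
Proof.
apply: spanned_map => _ [u [u0 su ->]].
rewrite -[M _ _](subrK ((if m == 0 then Mb else 0) *: word u)).
apply: spannedD; last exact/spannedZ/fil_word.
by apply: fil_le (M_word _ u0); apply: ltnW.
Qed.

Lemma fil_Mneq0 d m x : m != 0 -> fil d.+1 x -> fil d (M m x).
Proof.
move=> m0; apply: spanned_map => _ [u [u0 su ->]].
have := M_word m u0; rewrite (negbTE m0) scale0r subr0.
exact: fil_le.
Qed.

Hypothesis alpha_neq0 : forall n, n != 0 -> alpha n != 0.

(** The sum over all n is cut off at a finite [N]; any [N] containing the letters in play gives the
    same top-degree part. *)
Definition euler (N : seq int) (x : V) : V :=
  \sum_(n <- N) (alpha n)^-1 *: L n (M (- n) x).

Fact euler_is_linear N : linear (euler N).
Proof.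
move=> a x y; rewrite /euler scaler_sumr -big_split /=; apply: eq_bigr => n _.
by rewrite !linearP.
Qed.
HB.instance Definition _ N :=
  GRing.isLinear.Build k V V *:%R (euler N) (euler_is_linear N).

Lemma fil_euler d N x : 0 \notin N -> fil d x -> fil d (euler N x).
Proof.
move=> N0 fx; rewrite /euler big_seq.
elim/big_ind: _ => [|y z fy fz|n nN]; [exact: spanned0 | exact: spannedD |].
apply: spannedZ; have n0 : - n != 0.
  by rewrite oppr_eq0; apply: contraNneq N0 => <-.
case: d fx => [/fil0->|d fx]; first by rewrite !linear0; apply: spanned0.
exact/fil_L/fil_Mneq0.
Qed.

(** Leibniz rule: the commutator of (alpha n)^-1 L_n M_(-n) with a letter L_j is, modulo lower
    terms, - L_j if n = j and 0 otherwise, so each letter contributes -1. *)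
Lemma euler_word N u : uniq N -> 0 \notin N -> 0 \notin u -> {subset u <= N} ->
  fil (size u) (euler N (word u) + (size u)%:R *: word u).
Proof.
move=> uN N0; elim: u => [|j u IH] u0 uN'.
  rewrite scale0r addr0 /euler big_seq big1 => [|n nN]; first exact: spanned0.
  have n0 : - n != 0 by rewrite oppr_eq0; apply: contraNneq N0 => <-.
  by case: vec => _ _ _ _ v5; rewrite /= v5 // linear0 scaler0.
have jN : j \in N by apply: uN'; rewrite mem_head.
have {}uN' : {subset u <= N} by move=> i iu; apply: uN'; rewrite inE iu orbT.
move: u0; rewrite inE negb_or eq_sym => /andP[j0 u0].
have {}IH := IH u0 uN'.
set w := word u in IH *; rewrite /= -/w.
have fw : fil (size u).+1 w by apply: fil_word.
have term n : n \in N -> fil (size u).+1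
    ((alpha n)^-1 *: (L n (M (- n) (L j w)) - L j (L n (M (- n) w)))
     + (n == j)%:R *: L j w).
  move=> nN; have n0 : n != 0 by apply: contraNneq N0 => <-.
  have fM : fil (size u) (M (- n) w) by apply: fil_Mneq0; rewrite ?oppr_eq0.
  rewrite commML [L n (_ - _)]linearB /= (commLL n j) addrAC [_ + _ - L j _]addrAC subrr add0r.
  rewrite scalerBr -addrA; apply: spannedD.
    apply/spannedZ/spannedD; apply: spannedZ; first exact: fil_L.
    by apply: (@fil_le (size u)) => //; apply: fil_CL.
  rewrite CM_word -/w; have [->|nj] := eqVneq n j; last first.
    rewrite scale0r addr0 /cocycle eqr_opp (negbTE nj) scale0r addr0.
    apply/spannedN/spannedZ/fil_L/spannedZ/fil_Mneq0 => //.
    by rewrite subr_eq0 eq_sym.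
  (* For n = j the new M is M_0, which acts by [Mb] up to lower terms; the scalars add up to
     [alpha j]. *)
  have -> : (j - - j)%:~R *: M (j - j) w + cocycle k j (- j) *: (cM *: w)
     = (2 * j)%:~R *: (M 0 w - Mb *: w) + alpha j *: w.
    rewrite subrr opprK /cocycle eqxx /lowering_coef scalerBr scalerDl !scalerA addrA.
    by rewrite subrK mulrDl mul1r.
  rewrite linearD [L j (alpha j *: w)]linearZ /= scalerDr scalerA mulVf ?alpha_neq0 //.
  rewrite opprD -addrA addNr addr0; apply/spannedN/spannedZ/fil_L/spannedZ.
  exact: (M_word 0 u0).
have -> : euler N (L j w) + (size u).+1%:R *: L j w =
    L j (euler N w + (size u)%:R *: w) +
    \sum_(n <- N) ((alpha n)^-1 *: (L n (M (- n) (L j w)) - L j (L n (M (- n) w)))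
     + (n == j)%:R *: L j w).
  rewrite big_split /= -scaler_suml.
  have -> : \sum_(n <- N) (n == j)%:R = 1 :> k.
    by rewrite (bigD1_seq j) //= eqxx big1 ?addr0 // => n /negbTE->.
  under [X in _ + (X + _)]eq_bigr do rewrite scalerBr.
  rewrite sumrB linearD linear_sum /= linearZ /=.
  under [X in _ = X + _ + _]eq_bigr do rewrite linearZ /=.
  rewrite scale1r -natr1 scalerDl scale1r -/(euler _ _).
  by rewrite [RHS]addrACA [X in _ = X + _]addrC subrK.
apply: spannedD; first exact: fil_L.
rewrite big_seq; elim/big_ind: _ => [|y z fy fz|n nN]; [exact: spanned0 | exact: spannedD |].
exact: term.
Qed.

Lemma euler_fil d x : fil d.+1 x -> exists2 N, uniq N /\ 0 \notin N &
  fil d (euler N x + d%:R *: x).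
Proof.
(* Allowing every [N] that contains [N0] lets the lists of different words be merged. *)
move=> fx; suff [N0 N00 EN] : exists2 N0 : seq int, 0 \notin N0 &
    forall N, uniq N -> 0 \notin N -> {subset N0 <= N} -> fil d (euler N x + d%:R *: x).
  exists (undup N0); first by rewrite undup_uniq mem_undup.
  by apply: EN => [||n]; rewrite ?undup_uniq ?mem_undup.
elim: fx => [|a _ y [u [u0 su ->]] _ [N0 N00 EN]].
  by exists [::] => // N _ _ _; rewrite !linear0 addr0; apply: spanned0.
exists (u ++ N0) => [|N uN N0' sN]; first by rewrite mem_cat negb_or u0.
rewrite linearP scalerDr addrACA scalerA mulrC -scalerA -scalerDr.
apply: spannedD; last by apply: EN => // n nN0; apply: sN; rewrite mem_cat nN0 orbT.
apply: spannedZ; move: su; rewrite ltnS leq_eqVlt => /orP[/eqP <-|su].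
  by apply: euler_word => // n nu; apply: sN; rewrite mem_cat nu.
by apply: spannedD; [apply: fil_euler | apply: spannedZ]; rewrite ?N0' //; apply: fil_word.
Qed.

Hypothesis chark0 : [pchar k] =i pred0.

(** If some M_n with n <> 0 does not kill x, it moves x down the filtration inside [S]. Otherwise
    [euler] kills x, so a nonzero multiple of x already lies one step lower. At the bottom, [fil 1]
    is the line of v. *)
Lemma submodule_vacuum S d x : bms_submodule L M CL CM S ->
  fil d x -> x != 0 -> S x -> S v.
Proof.
case=> S0 Slin SLM _; elim: d x => [|d IH] x fx x0 Sx.
  by move: x0; rewrite (fil0 fx) eqxx.
case: d => [|d] in IH fx *.
  have [c xE] : exists c, x = c *: v.
    elim: fx => [|a _ y [u [_ + ->]] _ [c ->]]; first by exists 0; rewrite scale0r.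
    by rewrite ltnS leqn0 => /nilP->; exists (a + c); rewrite scalerDl.
  have c0 : c != 0 by apply: contraNneq x0 => c0; rewrite xE c0 scale0r.
  have -> : v = c^-1 *: x + 0 by rewrite xE scalerA mulVf // scale1r addr0.
  exact: Slin.
have [[n n0 Mx]|Mx] := pselect (exists2 n, n != 0 & M n x != 0).
  by apply: (IH (M n x)) => //; [apply: fil_Mneq0 | apply: (SLM n x Sx).2].
apply: (IH x) => //.
have [N [uN N0]] := euler_fil fx.
have -> : euler N x = 0.
  rewrite /euler big_seq big1 // => n nN; have [->|Mn] := eqVneq (M (- n) x) 0.
    by rewrite linear0 scaler0.
  case: Mx; exists (- n) => //; rewrite oppr_eq0.
  by apply: contraNneq N0 => <-.
have d0 : d.+1%:R != 0 :> k by move/pcharf0P: chark0 => ->.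
rewrite add0r => /(spannedZ (d.+1%:R^-1)).
by rewrite scalerA mulVf // scale1r.
Qed.

(** It contains v, so by [submodule_full] the filtration exhausts the massive module. *)
Lemma fil_submodule : bms_submodule L M CL CM (fun x => exists d, fil d x).
Proof.
split; first by exists 0%N; apply: spanned0.
- move=> a x y [d fx] [d' fy]; exists (maxn d d').
  by apply: spannedD; [apply: spannedZ; apply: fil_le fx | apply: fil_le fy];
     rewrite ?leq_maxl ?leq_maxr.
- by move=> n x [d fx]; split; [exists d.+1; apply: fil_L | exists d; apply: fil_M].
by move=> x [d fx]; split; exists d; [apply: fil_CL | apply: fil_CM].
Qed.

End Filtration.

(** * The two implications of the criterion *)

Lemma klinear_pack (k : fieldType) (V W : lmodType k) (f : V -> W) :
  klinear f -> exists g : {linear V -> W}, f = g.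
Proof.
move=> lf; pose l := GRing.isLinear.Build k V W *:%R f lf.
by exists (HB.pack_for {linear V -> W} f l).
Qed.

Lemma massive_irreducible (k : fieldType) (Mb s cL cM : k) (V : lmodType k)
  (L M : int -> V -> V) (CL CM : V -> V) (v : V) :
  [pchar k] =i pred0 -> is_massive_module Mb s cL cM L M CL CM v ->
  (forall n, n != 0 -> lowering_coef Mb cM n != 0) -> v != 0 ->
  bms_irreducible L M CL CM.
Proof.
move=> ch mass alpha0 v0; split=> [|S S_sub]; first by exists v.
have [rep vec _] := mass.
have [lL lM lCL lCM _] := rep.
have [L' LE] := choice (fun n => klinear_pack (lL n)).
have [M' ME] := choice (fun n => klinear_pack (lM n)).
have [CL' CLE] := klinear_pack lCL; have [CM' CME] := klinear_pack lCM.
have {}LE : L = L' by apply/funext.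
have {}ME : M = M' by apply/funext.
subst L M CL CM.
have [[x Sx x0]|S0] := pselect (exists2 x, S x & x != 0); last first.
  by left=> x Sx; apply/eqP; apply/negPn/negP => x0; apply: S0; exists x.
right; apply: (submodule_full S_sub mass).
have fv : exists d, fil L' v d v by exists 1%N; apply: (@fil_word _ _ L' v 1 [::]).
have [d fx] := submodule_full (fil_submodule rep vec) mass fv x.
exact: (submodule_vacuum rep vec alpha0 ch S_sub fx).
Qed.

Lemma lowering_coefE (k : fieldType) (Mb cM : k) (n : nat) : [pchar k] =i pred0 ->
  lowering_coef Mb cM n = (2 * n)%:R * (Mb + (n%:R ^+ 2 - 1) / 24%:R * cM).
Proof.
move=> /pcharf0P ch; have n12 : 12%:R != 0 :> k by rewrite ch.
have n24 : 24%:R != 0 :> k by rewrite ch.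
rewrite /lowering_coef !intrD !intrN rmorphXn /= !natrM !intrM -!pmulrn; field.
by rewrite n24 n12.
Qed.

Theorem theorem3p8 (k : fieldType) (chark0 : [pchar k] =i pred0)
  (Mb s cL cM : k) (V : lmodType k) (L M : int -> V -> V) (CL CM : V -> V)
  (v : V) :
  is_massive_module Mb s cL cM L M CL CM v ->
  (bms_irreducible L M CL CM <->
   forall n : nat, (0 < n)%N ->
     Mb + ((n%:R ^+ 2 - 1) / 24%:R) * cM != 0).
Proof.
move=> mass; have [rep vec univ] := mass.
have a0 : lowering_coef Mb cM 0 = 0 by rewrite /lowering_coef; ring.
have [W [L1 [M1 [CL1 [CM1 [w [rep1 vec1 w0 _ Lw]]]]]]] := massive_model s cL a0.
have [f [f_hom fv _]] := univ W L1 M1 CL1 CM1 w rep1 vec1.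
have hom0 (U U' : lmodType k) (g : U -> U') : klinear g -> g 0 = 0.
  by move=> /klinear_pack[g' ->]; rewrite linear0.
have [f_lin fL _ _ _] := f_hom.
split=> [[_ irr] n n_gt0|alpha_pos]; last first.
  apply: (massive_irreducible chark0 mass) => [n n0|]; last first.
    by apply: contraNneq w0 => v0; rewrite -fv v0 hom0.
  (* Positive modes suffice, the coefficient being odd in n. *)
  have apos m : (0 < m)%N -> lowering_coef Mb cM m != 0.
    move=> m0; rewrite lowering_coefE // mulf_neq0 ?alpha_pos //.
    by move/pcharf0P: chark0 => ->; rewrite muln_eq0 /= -lt0n.
  case: n n0 => m m0; first by apply: apos; rewrite lt0n.
  by rewrite NegzE lowering_coefN oppr_eq0 apos.
apply/eqP => E.
have an : lowering_coef Mb cM n = 0 by rewrite lowering_coefE // E mulr0.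
have [U [L2 [M2 [CL2 [CM2 [u [rep2 vec2 u0 Lu _]]]]]]] := massive_model s cL an.
have [g [[g_lin gL gM gCL gCM] gv _]] := univ U L2 M2 CL2 CM2 u rep2 vec2.
have [lL2 lM2 lCL2 lCM2 _] := rep2.
have n0 : n%:Z != 0 by rewrite eqz_nat -lt0n.
(* The kernel of g contains L_n v, nonzero because its image under f is, and misses v. *)
have [|ker0|kerT] := irr (fun x => g x = 0).
- split; first exact: hom0.
  + by move=> a x y gx gy; rewrite g_lin gx gy scaler0 addr0.
  + by move=> m x gx; rewrite gL gM gx !hom0.
  + by move=> x gx; rewrite gCL gCM gx !hom0.
- have /ker0 Lv : g (L n v) = 0 by rewrite gL gv Lu.
  by have := Lw n n0 n0; rewrite -fv -fL Lv hom0 // eqxx.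
by move: u0; rewrite -gv kerT eqxx.
Qed.
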